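(* Let $\bar A$, $\bar u$, $u_\delta$, $\bar z=\bar A^+\bar u$, the functions $x_k$ satisfying conditions A)–D), the matrices $\tilde A_h$, the number $\mu_\delta$ and the function $\beta_\delta$ be as defined in the context. Suppose that there is a constant $\delta_0>0$ such that $\|u_\delta\|>\mu_\delta$ for every $\delta$ with $0<\delta<\delta_0$, and let $h(\delta)>0$ be a generalized solution of the equation $\beta_\delta^2(h)=\delta^2+\mu_\delta^2$. Then the approximate solution $z_\delta=\tilde A_{h(\delta)}^+u_\delta$ of the system converges to the normal pseudosolution: $z_\delta\to\bar z$ as $\delta\to0$.
   Context: Let $m,n$ be positive integers and $M=\min(m,n)$. All vectors are real and carry the Euclidean norm; matrices carry the Euclidean (Frobenius) norm. $A^+$ denotes the Moore–Penrose pseudoinverse. $\bar A$ is a fixed real $m\times n$ matrix with $\|\bar A\|\ne0$, and $\bar u\in\mathbb R^m$ is a fixed exact right-hand side with $\|\bar u\|\neq 0$. The normal pseudosolution of $\bar Az=\bar u$ is the element of minimal norm among all minimizers of $\|\bar Az-\bar u\|$ over $z\in\mathbb R^n$; it equals $\bar z=\bar A^+\bar u$. For each $\delta>0$, $u_\delta\in\mathbb R^m$ is an approximate right-hand side with $\|u_\delta-\bar u\|\le\delta$; only $\delta$ small enough that $\|u_\delta\|\ne0$ are considered. Let $\bar A=U\bar RV^T$ be a singular value decomposition, with $U$ ($m\times m$) and $V$ ($n\times n$) orthogonal and $\bar R$ the $m\times n$ diagonal matrix $\bar R=\mathrm{diag}[\bar\rho_1,\dots,\bar\rho_{\bar r},0,\dots,0]$,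 $\bar\rho_k\ge\bar\rho_{k+1}\geq 0$, where $\bar r=\mathrm{rank}\,\bar A\le M$. Put $\theta(\rho)=\rho^{-1}$ for $\rho>0$ and $\theta(0)=0$. Fix a constant $H>0$ and functions $x_k:[0,H]\to[0,\infty)$, $k=1,\dots,M$, such that for all $k$: A) for every $0<h\le H$, either $x_k(h)=0$ or $1<x_k(h)\le c_k$, where $c_k$ is a constant; B) $x_k(+0)=x_k(0)=1$ (where $x_k(+0)$ is the right limit at $0$) and $x_k(H)=0$; C) $x_k$ is left continuous at every $h\in(0,H]$; D) the function $h\mapsto\theta[x_k(h)]$ is non-increasing on $[0,H]$. For $0\le h\le H$ put $\tilde A_h=U\tilde R_hV^T$, where $\tilde R_h=\mathrm{diag}[\bar\rho_1x_1(h),\dots,\bar\rho_{\bar r}x_{\bar r}(h),0,\dots,0]$ is $m\times n$. Put $\beta_\delta(h)=\|\bar A\tilde A_h^+u_\delta-u_\delta\|$ for $0\le h\le H$, and $\mu_\delta=\|\bar A\bar A^+u_\delta-u_\delta\|$ (so $\beta_\delta(0)=\mu_\delta$). A generalized solution of the equation $\beta_\delta^2(h)=\delta^2+\mu_\delta^2$ is a point $h(\delta)$ such that $\liminf_{h\to h(\delta)}\beta_\delta^2(h)=\beta_\delta^2(h(\delta)-0)\le\mu_\delta^2+\delta^2\le\beta_\delta^2(h(\delta)+0)=\limsup_{h\to h(\delta)}\beta_\delta^2(h)$, the limits being taken over $h$ in the domain $[0,H]$. *)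

(* Defs.v *)
From HB Require Import structures.
From mathcomp Require Import all_boot all_order all_algebra.
From mathcomp Require Import all_classical all_reals all_analysis.

Set Implicit Arguments.
Unset Strict Implicit.
Unset Printing Implicit Defensive.

Import Order.TTheory GRing.Theory Num.Theory.
Import numFieldNormedType.Exports.

Local Open Scope classical_set_scope.
Local Open Scope ring_scope.

(* The library norm on matrices is the sup norm; this is the Frobenius norm,
   i.e. the Euclidean norm on column vectors. *)
Definition enorm (R : realType) (m n : nat) (A : 'M[R]_(m, n)) : R :=
  Num.sqrt (\sum_i \sum_j A i j ^+ 2).

Definition penrose (R : realType) (m n : nat)
    (A : 'M[R]_(m, n)) (X : 'M[R]_(n, m)) : Prop :=
  [/\ A *m X *m A = A, X *m A *m X = X,
      (A *m X)^T = A *m X & (X *m A)^T = X *m A].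

(* Moore-Penrose pseudoinverse; mxalgebra's [pinvmx] is only a partial inverse.
   The default value 0 is never used, see [mpinvP]. *)
Definition mpinv (R : realType) (m n : nat) (A : 'M[R]_(m, n)) : 'M[R]_(n, m) :=
  xget 0 [set X | penrose A X].

Lemma gram_unitmx (R : realType) (r n : nat) (B : 'M[R]_(r, n)) :
  row_free B -> B *m B^T \in unitmx.
Proof.
move=> fB; rewrite -row_free_unit -kermx_eq0; apply/rowV0P => v /sub_kermxP.
rewrite mulmxA => vBB0.
have norm0 (w : 'rV[R]_n) : w *m w^T = 0 -> w = 0.
  move=> /matrixP/(_ 0 0); rewrite [LHS]mxE [RHS]mxE => s0.
  apply/rowP => j; rewrite [RHS]mxE; apply/eqP.
  have /psumr_eq0P/(_ s0 j isT)/eqP : forall k, true -> 0 <= w 0 k * w^T k 0.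
    by move=> k _; rewrite mxE -expr2 sqr_ge0.
  by rewrite mxE mulf_eq0 orbb.
have vB0 : v *m B = 0 by apply: norm0; rewrite trmx_mul mulmxA vBB0 mul0mx.
by apply: (row_free_inj fB); rewrite vB0 mul0mx.
Qed.

Lemma penrose_factor (R : realType) (m n r : nat)
    (C : 'M[R]_(m, r)) (B : 'M[R]_(r, n)) :
  row_full C -> row_free B -> exists X, penrose (C *m B) X.
Proof.
move=> fC fB.
have uG : B *m B^T \in unitmx by apply: gram_unitmx.
have uK : C^T *m C \in unitmx.
  by rewrite -{2}[C]trmxK; apply: gram_unitmx; rewrite /row_free mxrank_tr.
set G := invmx (B *m B^T); set K := invmx (C^T *m C).
have BG : B *m B^T *m G = 1%:M by rewrite mulmxV.
have KC : K *m (C^T *m C) = 1%:M by rewrite mulVmx.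
have tG : G^T = G by rewrite trmx_inv trmx_mul trmxK.
have tK : K^T = K by rewrite trmx_inv trmx_mul trmxK.
exists (B^T *m G *m K *m C^T).
have AX : C *m B *m (B^T *m G *m K *m C^T) = C *m K *m C^T.
  by rewrite -[X in _ = X *m K *m _](mulmx1 C) -BG !mulmxA.
have XA : B^T *m G *m K *m C^T *m (C *m B) = B^T *m G *m B.
  by rewrite -[X in _ = X *m B](mulmx1 (B^T *m G)) -KC !mulmxA.
split.
- by rewrite AX -[X in _ = X *m B](mulmx1 C) -KC !mulmxA.
- by rewrite XA -[X in _ = X *m K *m _](mulmx1 (B^T *m G)) -BG !mulmxA.
- by rewrite AX !trmx_mul trmxK tK mulmxA.
- by rewrite XA !trmx_mul trmxK tG mulmxA.
Qed.

Lemma penrose_exists (R : realType) (m n : nat) (A : 'M[R]_(m, n)) :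
  exists X, penrose A X.
Proof.
rewrite -[A]mulmx_base; apply: penrose_factor; first exact: col_base_full.
exact: row_base_free.
Qed.

Lemma mpinvP (R : realType) (m n : nat) (A : 'M[R]_(m, n)) :
  penrose A (mpinv A).
Proof. by have [X AX] := penrose_exists A; apply: (xgetPex 0); exists X. Qed.

Lemma penrose_uniq (R : realType) (m n : nat) (A : 'M[R]_(m, n))
    (X Y : 'M[R]_(n, m)) : penrose A X -> penrose A Y -> X = Y.
Proof.
move=> [AXA XAX tAX tXA] [AYA YAY tAY tYA].
have eAX : A *m X = A *m Y.
  rewrite -tAX -{1}AYA -mulmxA trmx_mul tAX tAY.
  by rewrite -[in RHS]AXA mulmxA.
have eXA : X *m A = Y *m A.
  rewrite -tXA -{1}AYA -mulmxA mulmxA trmx_mul tXA tYA.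
  by rewrite -[in RHS]AXA !mulmxA.
by rewrite -XAX -mulmxA eAX mulmxA eXA.
Qed.

Definition least_squares (R : realType) (m n : nat) (A : 'M[R]_(m, n))
    (u : 'cV[R]_m) (z : 'cV[R]_n) : Prop :=
  forall w : 'cV[R]_n, enorm (A *m z - u) <= enorm (A *m w - u).

Definition normal_pseudosolution (R : realType) (m n : nat)
    (A : 'M[R]_(m, n)) (u : 'cV[R]_m) (z : 'cV[R]_n) : Prop :=
  least_squares A u z /\
  forall w : 'cV[R]_n, least_squares A u w -> enorm z <= enorm w.

(* The m x n matrix with diagonal entries d_0, d_1, ... and zeros elsewhere. *)
Definition rectdiag (R : realType) (m n : nat) (d : 'I_(minn m n) -> R) :
    'M[R]_(m, n) :=
  \sum_k d k *: delta_mx (widen_ord (geq_minl m n) k)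
                         (widen_ord (geq_minr m n) k).

Definition is_svd (R : realType) (m n : nat) (A : 'M[R]_(m, n))
    (U : 'M[R]_m) (V : 'M[R]_n) (rho : 'I_(minn m n) -> R) : Prop :=
  [/\ U *m U^T = 1%:M /\ V *m V^T = 1%:M,
      forall k l : 'I_(minn m n), (k <= l)%N -> rho l <= rho k,
      forall k, 0 <= rho k,
      forall k : 'I_(minn m n), (\rank A <= k)%N -> rho k = 0 &
      A = U *m rectdiag rho *m V^T].

Definition theta (R : realType) (r : R) : R := if 0 < r then r^-1 else 0.

(* Conditions on one function x_k; its values outside [0, H] are irrelevant. *)
Definition regularizing (R : realType) (H : R) (x : R -> R) : Prop :=
  [/\ forall h, 0 <= h <= H -> 0 <= x h,
      exists c : R, forall h, 0 < h <= H -> x h = 0 \/ 1 < x h <= c,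
      [/\ x h @[h --> 0^'+] --> (1 : R), x 0 = 1 & x H = 0],
      forall h, 0 < h <= H -> x t @[t --> h^'-] --> x h &
      forall s t, 0 <= s -> s <= t -> t <= H -> theta (x t) <= theta (x s)].

Definition approx_matrix (R : realType) (m n : nat) (U : 'M[R]_m) (V : 'M[R]_n)
    (rho : 'I_(minn m n) -> R) (x : 'I_(minn m n) -> R -> R) (h : R) :
    'M[R]_(m, n) :=
  U *m rectdiag (fun k => rho k * x k h) *m V^T.

Definition discrepancy (R : realType) (m n : nat) (A : 'M[R]_(m, n))
    (At : R -> 'M[R]_(m, n)) (u : 'cV[R]_m) (h : R) : R :=
  enorm (A *m mpinv (At h) *m u - u).

Definition incompat (R : realType) (m n : nat) (A : 'M[R]_(m, n)) (u : 'cV[R]_m) : R :=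
  enorm (A *m mpinv A *m u - u).

(* All limits are relative to `[0, H].  At an endpoint of `[0, H] the outer
   one-sided neighbourhood filter relative to `[0, H] is degenerate, so the
   corresponding one-sided limit imposes nothing there. *)
Definition generalized_solution (R : realType) (H : R) (f : R -> R) (c h : R) :
    Prop :=
  0 <= h <= H /\
  exists l r : R,
    [/\ limf_einf (EFin \o f) (within `[0, H] h^') = l%:E,
        f t @[t --> within `[0, H] h^'-] --> l,
        l <= c <= r,
        f t @[t --> within `[0, H] h^'+] --> r &
        limf_esup (EFin \o f) (within `[0, H] h^') = r%:E].

(* Main.v *)
Require Import Defs.
From HB Require Import structures.
From mathcomp Require Import all_boot all_order all_algebra.
From mathcomp Require Import all_classical all_reals all_analysis.
From mathcomp Require Import ring lra.
Import Order.TTheory GRing.Theory Num.Theory.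
Import numFieldNormedType.Exports.
Local Open Scope classical_set_scope.
Local Open Scope ring_scope.

Set Implicit Arguments.
Unset Strict Implicit.
Unset Printing Implicit Defensive.


(** Write X for the pseudoinverse of Abar and Xh for that of the regularized
    matrix at the parameter h delta. The regularization is so tied to the
    singular vectors of Abar that Xh = X *m Abar *m Xh ([mpinv_approx_factor]),
    and the error of the approximate solution is therefore

      Xh *m u - X *m ubar = X *m ((Abar *m Xh *m u - Abar *m X *m u) + (u - ubar)).

    The second summand in the parentheses has norm at most delta. The first one
    is controlled by the choice of h delta: it lies in the range of Abar,
    whereas Abar *m X *m u - u is orthogonal to that range, so by Pythagoras
    ([residual_pythagoras]) its squared norm is the squared discrepancy at
    h delta minus the square of incompat Abar u. Once the squared discrepancy
    at h delta is known to be at most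
    delta ^+ 2 + incompat Abar u ^+ 2, the first summand also has norm at most
    delta, and the error is at most 2 delta times the Frobenius norm of X
    ([discrepancy_error_bound]). The method thus has a linear convergence rate.

    A generalized solution bounds only the left limit of the squared
    discrepancy, not its value. The two agree because the discrepancy is left
    continuous ([discrepancy_left_continuous]): it depends on the parameter only
    through the numbers (x k t)^-1, which are left continuous even where x k
    vanishes, as x k takes no values between 0 and 1 ([regularizing_inv_cvg]). *)

(** * The Frobenius norm *)

Lemma enorm_ge0 (R : realType) (m n : nat) (A : 'M[R]_(m, n)) : 0 <= enorm A.
Proof. exact: sqrtr_ge0. Qed.

Lemma enorm_sqr (R : realType) (m n : nat) (A : 'M[R]_(m, n)) :
  enorm A ^+ 2 = \sum_i \sum_j A i j ^+ 2.
Proof. by rewrite sqr_sqrtr//; do 2!apply: sumr_ge0 => ? _; exact: sqr_ge0. Qed.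

Lemma enorm_eq0P (R : realType) (m n : nat) (A : 'M[R]_(m, n)) :
  enorm A = 0 -> A = 0.
Proof.
move=> A0; apply/matrixP => i j; rewrite mxE; apply/eqP; rewrite -sqrf_eq0.
have rge0 k : 0 <= \sum_l A k l ^+ 2 by apply: sumr_ge0 => l _; exact: sqr_ge0.
have := enorm_sqr A; rewrite A0 expr0n /= => /esym.
move/psumr_eq0P => /(_ (fun k _ => rge0 k)) /(_ i isT).
by move/psumr_eq0P => /(_ (fun l _ => sqr_ge0 _)) /(_ j isT) ->.
Qed.

Lemma enorm_sqr_tr (R : realType) (m n : nat) (A : 'M[R]_(m, n)) :
  enorm A ^+ 2 = \tr (A^T *m A).
Proof.
rewrite enorm_sqr exchange_big; apply: eq_bigr => j _ /=.
by rewrite mxE; apply: eq_bigr => i _; rewrite mxE expr2.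
Qed.

(** The hypothesis A^T *m B = 0 makes every column of A orthogonal to every
    column of B, so that the cross terms of the Gram matrix vanish. *)
Lemma enorm_pythagoras (R : realType) (m n : nat) (A B : 'M[R]_(m, n)) :
  A^T *m B = 0 -> enorm (A + B) ^+ 2 = enorm A ^+ 2 + enorm B ^+ 2.
Proof.
move=> AB0; have BA0 : B^T *m A = 0.
  by rewrite -[B^T *m A]trmxK trmx_mul trmxK AB0 trmx0.
by rewrite !enorm_sqr_tr [(A + B)^T]linearD /= mulmxDl !mulmxDr AB0 BA0 addr0 add0r
  mxtraceD.
Qed.

Lemma enorm_sqrD (R : realType) (m n : nat) (A B : 'M[R]_(m, n)) :
  enorm (A + B) ^+ 2 <= (enorm A ^+ 2 + enorm B ^+ 2) *+ 2.
Proof.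
rewrite !enorm_sqr -big_split -sumrMnl; apply: ler_sum => i _ /=.
rewrite -big_split -sumrMnl; apply: ler_sum => j _ /=; rewrite mxE.
by have := sqr_ge0 (A i j - B i j); nra.
Qed.

(** Lagrange's identity: the difference of the two sides is half the sum of
    the squares (a_i b_j - a_j b_i)^2. *)
Lemma sum_cauchy_schwarz (R : realDomainType) (I : finType) (a b : I -> R) :
  (\sum_i a i * b i) ^+ 2 <= (\sum_i a i ^+ 2) * (\sum_i b i ^+ 2).
Proof.
have: 0 <= \sum_i \sum_j (a i * b j - a j * b i) ^+ 2.
  by do 2!apply: sumr_ge0 => ? _; exact: sqr_ge0.
have prodE (f g : I -> R) : \sum_i \sum_j f i * g j = (\sum_i f i) * (\sum_i g i).
  by rewrite mulr_suml; apply: eq_bigr => i _; rewrite mulr_sumr.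
suff -> : \sum_i \sum_j (a i * b j - a j * b i) ^+ 2 =
    ((\sum_i a i ^+ 2) * (\sum_i b i ^+ 2) - (\sum_i a i * b i) ^+ 2) *+ 2.
  by rewrite pmulrn_lge0// subr_ge0.
transitivity (\sum_i \sum_j (a i ^+ 2 * b j ^+ 2 + (b i ^+ 2 * a j ^+ 2 +
    (a i * b i * - (a j * b j) + a i * b i * - (a j * b j))))).
  by apply: eq_bigr => i _; apply: eq_bigr => j _; ring.
under eq_bigr do rewrite !big_split.
rewrite !big_split /= !prodE sumrN; ring.
Qed.

Lemma enorm_mulmx (R : realType) (m n p : nat) (A : 'M[R]_(m, n))
    (B : 'M[R]_(n, p)) : enorm (A *m B) <= enorm A * enorm B.
Proof.
rewrite -ler_sqr ?nnegrE ?mulr_ge0 ?enorm_ge0// exprMn !enorm_sqr.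
rewrite mulr_suml; apply: ler_sum => i _.
rewrite exchange_big mulr_sumr; apply: ler_sum => j _.
by rewrite mxE; exact: sum_cauchy_schwarz.
Qed.

Lemma cvg_sumr (R : realType) (I : finType) (T : Type) (F : set_system T)
    (FF : Filter F) (f : I -> T -> R) (l : I -> R) :
  (forall i, f i t @[t --> F] --> l i) ->
  \sum_i f i t @[t --> F] --> \sum_i l i.
Proof.
move=> fl; apply: cvg_big => [|i _]; last exact: fl.
exact: add_continuous.
Qed.

Lemma enorm_sqr_cvg (R : realType) (m n : nat) (T : Type) (F : set_system T)
    (FF : Filter F) (f : T -> 'M[R]_(m, n)) (A : 'M[R]_(m, n)) :
  (forall i j, f t i j @[t --> F] --> A i j) ->
  enorm (f t) ^+ 2 @[t --> F] --> enorm A ^+ 2.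
Proof.
move=> fA; rewrite enorm_sqr; under eq_fun do rewrite enorm_sqr.
apply: cvg_sumr => i; apply: cvg_sumr => j; exact: cvgM.
Qed.

(** * Least squares and the pseudoinverse *)

Lemma mpinv_eq (R : realType) (m n : nat) (A : 'M[R]_(m, n)) X :
  penrose A X -> mpinv A = X.
Proof. exact/penrose_uniq/mpinvP. Qed.

(** A *m mpinv A is the orthogonal projector onto the range of A, hence the
    residual is orthogonal to that range. *)
Lemma mpinv_residual_orth (R : realType) (m n p : nat) (A : 'M[R]_(m, n))
    (u : 'M[R]_(m, p)) : A^T *m (A *m mpinv A *m u - u) = 0.
Proof.
have [AXA _ tAX _] := mpinvP A.
by rewrite mulmxBr mulmxA -tAX -trmx_mul AXA subrr.
Qed.

(** A *m z - u splits into a part in the range of A and the residual of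
    mpinv A *m u, which is orthogonal to it. In particular incompat A u is the
    least possible residual. *)
Lemma residual_pythagoras (R : realType) (m n : nat) (A : 'M[R]_(m, n))
    (u : 'cV[R]_m) (z : 'cV[R]_n) :
  enorm (A *m z - u) ^+ 2 =
  enorm (A *m (z - mpinv A *m u)) ^+ 2 + incompat A u ^+ 2.
Proof.
rewrite -enorm_pythagoras; last first.
  by rewrite trmx_mul -[LHS]mulmxA mpinv_residual_orth mulmx0.
by rewrite mulmxBr mulmxA addrA subrK.
Qed.

(** Minimality of the residual is [residual_pythagoras]. By the same identity
    two least-squares solutions have the same image under A, so each of them
    has mpinv A *m u as its image under the orthogonal projector mpinv A *m A,
    and orthogonal projection does not increase the norm. *)
Lemma mpinv_normal_pseudosolution (R : realType) (m n : nat) (A : 'M[R]_(m, n))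
    (u : 'cV[R]_m) : normal_pseudosolution A u (mpinv A *m u).
Proof.
have [AXA XAX _ tXA] := mpinvP A.
split=> w => [|lsw].
  rewrite -ler_sqr ?nnegrE ?enorm_ge0// [in leRHS]residual_pythagoras.
  by rewrite mulmxA lerDr sqr_ge0.
have Aw : A *m (w - mpinv A *m u) = 0.
  apply: enorm_eq0P; apply/eqP; rewrite -sqrf_eq0
    -[X in X == 0](addrK (incompat A u ^+ 2)).
  rewrite -residual_pythagoras subr_eq0 eq_le ler_sqr ?nnegrE ?enorm_ge0//.
  apply/andP; split; first by have := lsw (mpinv A *m u); rewrite mulmxA.
  by rewrite residual_pythagoras lerDr sqr_ge0.
have XAw : mpinv A *m A *m w = mpinv A *m u.
  apply/eqP; rewrite -subr_eq0 -mulmxA -[X in _ - X *m u]XAX -!mulmxA.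
  by rewrite -!mulmxBr Aw mulmx0.
rewrite -ler_sqr ?nnegrE ?enorm_ge0// -XAw.
rewrite -[in leRHS](subrKC (mpinv A *m A *m w) w)
  enorm_pythagoras ?lerDl ?sqr_ge0//.
rewrite trmx_mul tXA -[LHS]mulmxA mulmxBr [X in _ - X]mulmxA.
by rewrite [X in _ - X *m w]mulmxA XAX subrr mulmx0.
Qed.

(** * Pseudoinverse from a singular value decomposition *)

Lemma mulmx_sum_delta (R : realType) (I : finType) (p q s : nat)
    (f : I -> 'I_p) (g : I -> 'I_q) (e : I -> 'I_s) (a b : I -> R) :
  injective g ->
  (\sum_k a k *: delta_mx (f k) (g k)) *m (\sum_k b k *: delta_mx (g k) (e k)) =
  \sum_k (a k * b k) *: delta_mx (f k) (e k).
Proof.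
move=> g_inj; rewrite mulmx_suml; apply: eq_bigr => k _.
rewrite mulmx_sumr (bigD1 k) //= big1 => [|l lk].
  by rewrite -scalemxAl -scalemxAr mul_delta_mx scalerA addr0.
rewrite -scalemxAl -scalemxAr mul_delta_mx_0 ?scaler0//.
by apply: contra_neq lk => /g_inj.
Qed.

Lemma trmx_rectdiag (R : realType) (m n : nat) (d : 'I_(minn m n) -> R) :
  (rectdiag d)^T = \sum_k d k *:
    delta_mx (widen_ord (geq_minr m n) k) (widen_ord (geq_minl m n) k).
Proof.
by rewrite linear_sum; apply: eq_bigr => k _; rewrite linearZ /= trmx_delta.
Qed.

Lemma widen_ord_inj (p q : nat) (pq : (p <= q)%N) : injective (widen_ord pq).
Proof. by move=> i j /(congr1 val) ij; exact: val_inj. Qed.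

Lemma rectdiag_mul_tr (R : realType) (m n : nat) (a b : 'I_(minn m n) -> R) :
  rectdiag a *m (rectdiag b)^T = \sum_k (a k * b k) *:
    delta_mx (widen_ord (geq_minl m n) k) (widen_ord (geq_minl m n) k).
Proof. by rewrite trmx_rectdiag mulmx_sum_delta//; exact: widen_ord_inj. Qed.

Lemma rectdiag_tr_mul (R : realType) (m n : nat) (a b : 'I_(minn m n) -> R) :
  (rectdiag a)^T *m rectdiag b = \sum_k (a k * b k) *:
    delta_mx (widen_ord (geq_minr m n) k) (widen_ord (geq_minr m n) k).
Proof. by rewrite trmx_rectdiag mulmx_sum_delta//; exact: widen_ord_inj. Qed.

Lemma rectdiag_mul3 (R : realType) (m n : nat) (a b c : 'I_(minn m n) -> R) :
  rectdiag a *m (rectdiag b)^T *m rectdiag c =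
  rectdiag (fun k => a k * b k * c k).
Proof. by rewrite rectdiag_mul_tr mulmx_sum_delta//; exact: widen_ord_inj. Qed.

(** Since 0^-1 = 0 in a field, taking entrywise inverses on the diagonal
    inverts the nonzero entries and keeps the zero ones, which is the
    pseudoinverse of the diagonal factor. *)
Lemma mpinv_svd (R : realType) (m n : nat) (U : 'M[R]_m) (V : 'M[R]_n)
    (d : 'I_(minn m n) -> R) : U *m U^T = 1%:M -> V *m V^T = 1%:M ->
  mpinv (U *m rectdiag d *m V^T) =
  V *m (rectdiag (fun k => (d k)^-1))^T *m U^T.
Proof.
move=> /mulmx1C UU /mulmx1C VV; apply: mpinv_eq.
set D := rectdiag d; set E := rectdiag _.
have dVd k : d k * (d k)^-1 * d k = d k.
  by have [->|d0] := eqVneq (d k) 0; rewrite ?mulr0// divfK.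
have DED : D *m E^T *m D = D.
  by rewrite rectdiag_mul3; congr rectdiag; apply/funext.
have EDE : E^T *m D *m E^T = E^T.
  apply: trmx_inj; rewrite !trmx_mul !trmxK mulmxA rectdiag_mul3.
  by congr rectdiag; apply/funext => k; rewrite -[in RHS](dVd k) !invfM invrK.
have DEE : (D *m E^T)^T = D *m E^T.
  rewrite trmx_mul trmxK !rectdiag_mul_tr.
  by apply: eq_bigr => k _; rewrite mulrC.
have EDD : (E^T *m D)^T = E^T *m D.
  rewrite trmx_mul trmxK !rectdiag_tr_mul.
  by apply: eq_bigr => k _; rewrite mulrC.
have AX : U *m D *m V^T *m (V *m E^T *m U^T) = U *m (D *m E^T) *m U^T.
  by rewrite !mulmxA -(mulmxA _ V^T) VV mulmx1.
have XA : V *m E^T *m U^T *m (U *m D *m V^T) = V *m (E^T *m D) *m V^T.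
  by rewrite !mulmxA -(mulmxA _ U^T) UU mulmx1.
split.
- by rewrite AX !mulmxA -(mulmxA _ U^T) UU mulmx1 -!(mulmxA U) DED.
- by rewrite XA !mulmxA -(mulmxA _ V^T) VV mulmx1 -!(mulmxA V) EDE.
- by rewrite AX trmx_mul trmxK [X in _ *m X]trmx_mul DEE mulmxA.
- by rewrite XA trmx_mul trmxK [X in _ *m X]trmx_mul EDD mulmxA.
Qed.

(** mpinv A *m A projects onto the span of the right singular vectors with
    rho k != 0, and the range of the regularized pseudoinverse lies in that
    span. This is what allows an error in the solution to be written as the
    image under mpinv A of an error in the right-hand side. *)
Lemma mpinv_approx_factor (R : realType) (m n : nat) (A : 'M[R]_(m, n))
    (U : 'M[R]_m) (V : 'M[R]_n) (rho : 'I_(minn m n) -> R)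
    (x : 'I_(minn m n) -> R -> R) (h : R) :
  is_svd A U V rho ->
  mpinv A *m A *m mpinv (approx_matrix U V rho x h) =
  mpinv (approx_matrix U V rho x h).
Proof.
move=> [[UU VV] _ _ _ ->]; rewrite !mpinv_svd//.
rewrite !mulmxA -(mulmxA _ U^T U) (mulmx1C UU) mulmx1.
rewrite -(mulmxA _ V^T V) (mulmx1C VV) mulmx1 -!(mulmxA V); congr (V *m (_ *m _)).
apply: trmx_inj; rewrite !trmx_mul !trmxK mulmxA rectdiag_mul3.
congr rectdiag; apply/funext => k; rewrite invfM.
by have [->|r0] := eqVneq (rho k) 0; rewrite ?invr0 ?mulr0 ?mul0r// mulfK.
Qed.

(** * Left continuity of the discrepancy *)

(** The dependence on the parameter is only through the scalar coefficients
    (x k t)^-1, so continuity questions become scalar ones. *)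
Lemma mpinv_approx_sum (R : realType) (m n : nat)
    (U : 'M[R]_m) (V : 'M[R]_n) (rho : 'I_(minn m n) -> R)
    (x : 'I_(minn m n) -> R -> R) : U *m U^T = 1%:M -> V *m V^T = 1%:M ->
  exists W : 'I_(minn m n) -> 'M[R]_(n, m), forall t,
  mpinv (approx_matrix U V rho x t) = \sum_k (x k t)^-1 *: W k.
Proof.
move=> UU VV; exists (fun k => (rho k)^-1 *: (V *m
  delta_mx (widen_ord (geq_minr m n) k) (widen_ord (geq_minl m n) k) *m U^T)).
move=> t; rewrite mpinv_svd// trmx_rectdiag mulmx_sumr mulmx_suml.
apply: eq_bigr => k _.
by rewrite -scalemxAr -scalemxAl invfM scalerA mulrC.
Qed.

(** Inversion is discontinuous at 0, but x cannot approach 0 through nonzero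
    values, since its nonzero values exceed 1: if x h = 0 then, by left
    continuity, x vanishes identically just before h. *)
Lemma regularizing_inv_cvg (R : realType) (H : R) (x : R -> R) (h : R) :
  regularizing H x -> 0 < h <= H ->
  (x t)^-1 @[t --> h^'-] --> (x h)^-1.
Proof.
move=> [_ [c xc] _ xl _] hH; have xh := xl h hH.
have [xh0|xh0] := eqVneq (x h) 0; last exact: cvgV.
rewrite xh0 in xh *; have /andP[h0 hle] := hH.
have x0 : \forall t \near h^'-, x t = 0.
  near=> t.
  have tH : 0 < t <= H.
    apply/andP; split; first by near: t; exact: nbhs_left_gt.
    by apply: le_trans hle; apply: ltW; near: t; exact: nbhs_left_lt.
  case: (xc t tH) => // /andP[x1 _].
  have : x t < 1 by near: t; exact: (cvgr_lt 0).
  by rewrite ltNge (ltW x1).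
rewrite invr0; apply: cvg_near_cst.
by apply: filterS x0 => t ->; rewrite invr0.
Unshelve. all: by end_near. Qed.

Lemma discrepancy_left_continuous (R : realType) (m n : nat) (A : 'M[R]_(m, n))
    (U : 'M[R]_m) (V : 'M[R]_n) (rho : 'I_(minn m n) -> R) (H : R)
    (x : 'I_(minn m n) -> R -> R) (u : 'cV[R]_m) (h : R) :
  U *m U^T = 1%:M -> V *m V^T = 1%:M ->
  (forall k, regularizing H (x k)) -> 0 < h <= H ->
  discrepancy A (approx_matrix U V rho x) u t ^+ 2 @[t --> h^'-] -->
  discrepancy A (approx_matrix U V rho x) u h ^+ 2.
Proof.
move=> UU VV xP hH; apply: enorm_sqr_cvg => i j.
have [W WE] := @mpinv_approx_sum R m n U V rho x UU VV.
have E t : (A *m mpinv (approx_matrix U V rho x t) *m u - u) i j =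
    \sum_k (x k t)^-1 * (A *m W k *m u) i j - u i j.
  rewrite WE mulmx_sumr mulmx_suml !mxE summxE; congr (_ - _).
  by apply: eq_bigr => k _; rewrite -scalemxAr -scalemxAl mxE.
rewrite E; under eq_fun do rewrite E.
apply: cvgB; last exact: cvg_cst.
apply: cvg_sumr => k; apply: cvgMl; exact: regularizing_inv_cvg.
Qed.

(** * Error bound and convergence *)

(** Just left of h > 0 the restriction to [0, H] is immaterial, so the left
    limit that a generalized solution bounds by c is the value f h. *)
Lemma generalized_solution_le (R : realType) (H : R) (f : R -> R) (c h : R) :
  0 < h -> f t @[t --> h^'-] --> f h -> generalized_solution H f c h -> f h <= c.
Proof.
move=> h0 fh [/andP[_ hH] [l [r [_ fl /andP[lc _] _ _]]]].
suff fl' : f t @[t --> h^'-] --> l by rewrite (cvg_unique _ fh fl').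
apply: cvg_trans fl; apply: cvg_app => P.
rewrite /within /= => wP.
have h_in : \forall t \near h^'-, t \in `[0, H].
  near=> t; rewrite in_itv /=; apply/andP; split.
    by apply: ltW; near: t; exact: nbhs_left_gt.
  by apply: le_trans hH; apply: ltW; near: t; exact: nbhs_left_lt.
by apply: filterS2 h_in wP => t tH; exact.
Unshelve. all: by end_near. Qed.

(** The error is mpinv A applied to the sum of a fit error in the range of A
    and the data error u - ubar. The discrepancy inequality and
    [residual_pythagoras] bound the first by delta, as incompat A u ^+ 2
    cancels. *)
Lemma discrepancy_error_bound (R : realType) (m n : nat) (A : 'M[R]_(m, n))
    (X : 'M[R]_(n, m)) (u ubar : 'cV[R]_m) (delta : R) :
  mpinv A *m A *m X = X -> 0 <= delta -> enorm (u - ubar) <= delta ->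
  enorm (A *m X *m u - u) ^+ 2 <= delta ^+ 2 + incompat A u ^+ 2 ->
  enorm (X *m u - mpinv A *m ubar) <= enorm (mpinv A) * (delta *+ 2).
Proof.
move=> XE d0 ud; rewrite -mulmxA residual_pythagoras lerD2r => Ad.
have [_ XAX _ _] := mpinvP A.
have -> : X *m u - mpinv A *m ubar =
    mpinv A *m (A *m (X *m u - mpinv A *m u) + (u - ubar)).
  rewrite mulmxDr !mulmxBr !mulmxA XE XAX.
  by rewrite addrA subrK.
apply: le_trans (enorm_mulmx _ _) _; apply: ler_wpM2l; first exact: enorm_ge0.
rewrite -ler_sqr ?nnegrE ?enorm_ge0 ?mulrn_wge0//.
apply: le_trans (enorm_sqrD _ _) _.
have : enorm (u - ubar) ^+ 2 <= delta ^+ 2 by rewrite ler_sqr ?nnegrE ?enorm_ge0.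
by move: Ad; nra.
Qed.

Theorem theorem2 (R : realType) (m n : nat) (m_gt0 : (0 < m)%N) (n_gt0 : (0 < n)%N)
    (Abar : 'M[R]_(m, n)) (Abar_neq0 : enorm Abar != 0)
    (ubar : 'cV[R]_m) (ubar_neq0 : enorm ubar != 0)
    (U : 'M[R]_m) (V : 'M[R]_n) (rho : 'I_(minn m n) -> R)
    (svdA : is_svd Abar U V rho)
    (H : R) (H_gt0 : 0 < H)
    (x : 'I_(minn m n) -> R -> R) (xP : forall k, regularizing H (x k))
    (u : R -> 'cV[R]_m)
    (u_approx : forall delta : R, 0 < delta -> enorm (u delta - ubar) <= delta)
    (delta0 : R) (delta0_gt0 : 0 < delta0)
    (u_gt_mu : forall delta : R, 0 < delta < delta0 ->
       incompat Abar (u delta) < enorm (u delta))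
    (h : R -> R)
    (hP : \forall delta \near (0 : R)^'+,
       0 < h delta /\
       generalized_solution H
         (fun t => discrepancy Abar (approx_matrix U V rho x) (u delta) t ^+ 2)
         (delta ^+ 2 + incompat Abar (u delta) ^+ 2) (h delta)) :
  normal_pseudosolution Abar ubar (mpinv Abar *m ubar) /\
  enorm (mpinv (approx_matrix U V rho x (h delta)) *m u delta
         - mpinv Abar *m ubar) @[delta --> (0 : R)^'+] --> (0 : R).
Proof.
split; first exact: mpinv_normal_pseudosolution.
have [[UU VV] _ _ _ _] := svdA.
apply: (@squeeze_cvgr _ _ _ _ (cst 0)
    (fun delta => enorm (mpinv Abar) * (delta *+ 2))).
- near=> delta; rewrite enorm_ge0 /=.
  have d0 : 0 < delta by near: delta; exact: nbhs_right_gt.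
  have [hd0 hgen] : 0 < h delta /\ generalized_solution H
      (fun t => discrepancy Abar (approx_matrix U V rho x) (u delta) t ^+ 2)
      (delta ^+ 2 + incompat Abar (u delta) ^+ 2) (h delta).
    by near: delta.
  have hH : 0 < h delta <= H by rewrite hd0; case: hgen => /andP[_ ->].
  apply: discrepancy_error_bound (ltW d0) (u_approx _ d0) _.
    exact: mpinv_approx_factor.
  apply: generalized_solution_le hd0 _ hgen.
  exact: discrepancy_left_continuous.
- exact: cvg_cst.
- rewrite -[X in _ --> X](mulr0 (enorm (mpinv Abar))).
  apply: cvgMr; rewrite -[X in _ --> X](mul0rn _ 2).
  under eq_fun do rewrite mulr2n.
  by rewrite mulr2n; apply: cvgD; apply: cvg_at_right_filter; exact: cvg_id.
Unshelve. all: by end_near. Qed.
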